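(* The pair $(\{Q_k(x;y)\}_{k=0}^\infty,\{(2k+1)!\}_{k=0}^\infty)$ is a palindromic pair with degree $\frac{n-2}{2}$. Namely, let $n\in2(1+\mathbb{Z}_{\ge0})$ and $s\in\mathscr{S}_{\frac n2}(Q;n)$. Then $Q_k(s;n)=0$ for $k\ge\frac n2$, and $$\frac{Q_k(s;n)}{(2k+1)!}=\theta_{(Q;n)}(s)\,\frac{Q_{\frac{n-2}{2}-k}(s;n)}{(n-2k-1)!}\qquad\text{for } k\le\tfrac{n-2}{2}.$$ Equivalently, for $k\le\frac n2-1$ this palindromic identity is given as follows. (1) If $n\equiv0\pmod4$: $\displaystyle\frac{Q_k(s;n)}{(2k+1)!}=\mathrm{sgn}(s)\frac{Q_{\frac{n-2}{2}-k}(s;n)}{(n-2k-1)!}$ for $s\in I_0^+\cup I_0^-$. (2) If $n\equiv2\pmod4$: $\displaystyle\frac{Q_k(s;n)}{(2k+1)!}=\frac{Q_{\frac{n-2}{2}-k}(s;n)}{(n-2k-1)!}$ for all $s\in\mathbb{C}$.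
   Context: Palindromic pairs. Let $\{p_k(x;y)\}_{k=0}^\infty$ be a sequence of polynomials in two variables with $p_0(x;y)=1$, $\{a_k\}_{k=0}^\infty$ a sequence of non-zero numbers, and $d\colon\mathbb{Z}_{\ge0}\to\mathbb{R}$ a map. For $n\in\mathbb{Z}_{\ge0}$ put $\mathscr{S}_k(p;n)=\{s\in\mathbb{C}:p_k(s;n)=0\}$. The pair $(\{p_k\},\{a_k\})$ is a palindromic pair with degree $d(n)$ if, for each $n\in\mathbb{Z}_{\ge 0}$ with $d(n)\in\mathbb{Z}_{\ge0}$, there exists a map $\theta_{(p;n)}\colon\mathscr{S}_{d(n)+1}(p;n)\to\{\pm1\}$ such that for all $s\in\mathscr{S}_{d(n)+1}(p;n)$ we have $p_k(s;n)=0$ for $k\ge d(n)+1$ and $\frac{p_k(s;n)}{a_k}=\theta_{(p;n)}(s)\frac{p_{d(n)-k}(s;n)}{a_{d(n)-k}}$ for $0\le k\le d(n)$. The polynomials. Put $b(x)=2x(2x+1)$. $Q_0(x;y)=1$, and for $k\ge1$, $Q_k(x;y)$ is the determinant of the $k\times k$ tridiagonal matrix with diagonal entries $(y-2-4(i-1))x$ in position $(i,i)$ $(1\le i\le k)$, entries $b(i)$ in position $(i,i+1)$, and entries $-b\left(\frac{y-2i}{2}\right)$ in position $(i+1,i)$ $(1\le i\le k-1)$. For $n\in4\mathbb{Z}_{\ge0}$, $I_0^\pm=\{\pm(3+4j):j=0,1,\ldots,\frac n4-1\}$. For $n\in2(1+\mathbb{Z}_{\ge0})$ one has $\mathscr{S}_{\frac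 n2}(Q;n)=I_0^+\cup I_0^-$ if $n\equiv0\pmod4$ and $\mathscr{S}_{\frac n2}(Q;n)=\mathbb{C}$ if $n\equiv2\pmod4$. The map $\theta_{(Q;n)}$ on this set is $\theta_{(Q;n)}(s)=\mathrm{sgn}(s)$ if $n\equiv0\pmod4$ and $\theta_{(Q;n)}(s)=1$ if $n\equiv2\pmod4$, where $\mathrm{sgn}(s)=\pm1$ is the sign of the non-zero real number $s$. *)

(* Defs.v *)
From mathcomp Require Import all_boot all_order all_algebra.
From mathcomp Require Import classical_sets reals.
From mathcomp.real_closed Require Import complex.

Set Implicit Arguments.
Unset Strict Implicit.
Unset Printing Implicit Defensive.

Import Order.TTheory GRing.Theory Num.Theory.
Local Open Scope ring_scope.

(* Polynomials in x and y are bivariate polynomials in the sense of polyXY: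
   x is 'X, y is 'Y, and p.[s, t] is the value of p at x = s, y = t. *)

Definition zero_set (F : fieldType) (p : nat -> {poly {poly F}}) (k n : nat) :
    set F :=
  [set s | (p k).[s, n%:R] = 0]%classic.

(* A natural number m with d n = m%:R witnesses that d n is a nonnegative
   integer; only the values of theta on the zero set matter. *)
Definition palindromic_pair (R : realType) (p : nat -> {poly {poly R[i]}})
    (a : nat -> R[i]) (d : nat -> R) : Prop :=
  [/\ p 0%N = 1,
      forall k : nat, a k != 0
    & forall n m : nat, d n = m%:R ->
      exists theta : R[i] -> R[i],
        forall s : R[i], zero_set p m.+1 n s ->
          [/\ theta s = 1 \/ theta s = -1,
              forall k : nat, (m.+1 <= k)%N -> (p k).[s, n%:R] = 0
            & forall k : nat, (k <= m)%N ->
                (p k).[s, n%:R] / a k =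
                theta s * ((p (m - k)%N).[s, n%:R] / a (m - k)%N)]].

Definition b (A : nzRingType) (x : A) : A := 2%:R * x * (2%:R * x + 1).

(* The entry in position (i, j), rows and columns being numbered from 1. *)
Definition Q_entry (F : fieldType) (i j : nat) : {poly {poly F}} :=
  if j == i then ('Y - 2%:R - 4%:R * (i%:R - 1)) * 'X
  else if j == i.+1 then b i%:R
  else if i == j.+1 then - b ((2%:R^-1)%:P%:P * ('Y - 2%:R * j%:R))
  else 0.

(* For k = 0 the determinant of the empty matrix is 1. *)
Definition Q (F : fieldType) (k : nat) : {poly {poly F}} :=
  \det (\matrix_(i < k, j < k) Q_entry F i.+1 j.+1).

Definition I0_plus (F : fieldType) (n : nat) : set F :=
  [set s | exists2 j : nat, (j < n %/ 4)%N & s = (3 + 4 * j)%:R]%classic.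

Definition I0_minus (F : fieldType) (n : nat) : set F :=
  [set s | exists2 j : nat, (j < n %/ 4)%N & s = - (3 + 4 * j)%:R]%classic.

(* On R[i], Num.sg s is the usual sign 1, 0 or -1 when s is real. *)
Definition theta_Q (F : numFieldType) (n : nat) (s : F) : F :=
  if (4 %| n)%N then Num.sg s else 1.

(* Main.v *)
Require Import Defs.
From mathcomp Require Import all_boot all_order all_algebra.
From mathcomp Require Import classical_sets reals.
From mathcomp.real_closed Require Import complex.
From mathcomp Require Import ring zify.

Set Implicit Arguments.
Unset Strict Implicit.
Unset Printing Implicit Defensive.

Import Order.TTheory GRing.Theory Num.Theory.
Local Open Scope ring_scope.

(** Write n = 2N + 2 and q_k(s) = Q_k(s; n) / (2k + 1)!. Expanding the
    tridiagonal determinant along its last row turns into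
      b(k+1) q_(k+1) = 2 (N - 2k) s q_k + b(N-k+1) q_(k-1),   q_(-1) = 0,
    a relation that is invariant under the reversal k <-> N - k
    ([three_term_mirror]). If q_(N+1)(s) = 0, then k |-> q_(N-k) satisfies the
    same recurrence with the same initial condition, so it is a multiple of q:
    q_(N-k) = q_N q_k, whence q_N ^ 2 = 1 ([qval_mirror], [qval_last]). As the
    coefficient b(N-k+1) vanishes at k = N + 1, all later q_k vanish too
    ([qval_vanish]). This is the palindromic property with theta = q_N(s), and
    it remains to find the zeros of q_(N+1) and the sign q_N(s).

    If N is even, the middle relation loses its term in s, so q is symmetric
    around N/2 and runs back to q_(-1) = 0: for every s, q_N = 1 and
    q_(N+1) = 0 ([qval_even]).

    If N is odd, consider the generating function G = sum_k q_k t^(2k+1). The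
    recurrence says that G solves a second order differential equation (of
    Heun type, singular where t^4 = 1):
      G'' - t^2 (n-1-E)(n-E) G - s (n - 2E) G = 0,   E = t d/dt.
    The operator preserves parity, so the odd part of any of its power series
    solutions is a multiple of G. In terms of the sl_2 operators
      X = d/dt,   Y = t (n - E),   H = n - 2E
    on polynomials of degree at most n, it is X^2 - Y^2 - s H. The products
    (1 + t)^p (1 - t)^q with p + q = n are the eigenvectors of X + Y, and
    X^2 - Y^2 - s H sends such a product to a combination of its two neighbours
    only ([heun_bipower]). For s = 3 + 4j one of the coefficients met along the
    chain with p, q even vanishes, so that a solution supported on one end of
    this chain can be written down ([eigenpoly], [heun_eigenpoly]). Its
    coefficients on these products are nonnegative, so its coefficient of t is
    positive, and its odd coefficients are proportional to the q_k. Each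
    product with q even is a palindromic polynomial, which gives q_N = 1, and
    the degree bound gives q_(N+1) = 0 ([qval_eigenvalue]). The parity
    q_k(-s) = (-1)^k q_k(s) handles the values -(3 + 4j), and since q_(N+1) has
    degree N + 1 in s, these N + 1 numbers are all of its zeros
    ([qval_zero]). *)

(** * The three-term recurrence *)

(** The continuant recurrence: in the last row only two entries survive, and
    removing the second of them leaves a minor whose last column has a single
    nonzero entry. *)
Lemma det_tridiagonal (A : comNzRingType) (t : nat -> nat -> A) (k : nat) :
    (forall i j, (i.+1 < j)%N -> t i j = 0) ->
    (forall i j, (j.+1 < i)%N -> t i j = 0) ->
  \det (\matrix_(i < k.+2, j < k.+2) t i j) =
    t k.+1 k.+1 * \det (\matrix_(i < k.+1, j < k.+1) t i j)
    - t k.+1 k * t k k.+1 * \det (\matrix_(i < k, j < k) t i j).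
Proof.
move=> tU tL; rewrite (expand_det_row _ ord_max).
rewrite !big_ord_recr /= big1 ?add0r; last first.
  by move=> j _; rewrite mxE tL ?mul0r //= !ltnS.
rewrite !mxE /= addrC; congr (_ + _).
  rewrite /cofactor addnn -signr_odd odd_double expr0 mul1r; congr (_ * \det _).
  by apply/matrixP => i j; rewrite !mxE !lift_max.
rewrite -mulrA -mulrN; congr (_ * _).
rewrite /cofactor /= addSn addnn -signr_odd /= odd_double expr1 mulN1r.
congr (- _).
rewrite (expand_det_col _ ord_max) big_ord_recr /= big1 ?add0r; last first.
  move=> i _; rewrite !mxE lift_max /= tU ?mul0r //= /bump.
  by rewrite leqnn add1n !ltnS.
rewrite !mxE lift_max /= /bump leqnn add1n; congr (_ * _).
rewrite /cofactor addnn -signr_odd odd_double expr0 mul1r; congr (\det _).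
apply/matrixP => i j; rewrite !mxE !lift_max /= !/bump.
by rewrite !(leqNgt k) !ltn_ord.
Qed.

Lemma Q_recurrence (F : fieldType) (k : nat) :
  Q F k.+2 = Q_entry F k.+2 k.+2 * Q F k.+1
             - Q_entry F k.+2 k.+1 * Q_entry F k.+1 k.+2 * Q F k.
Proof.
apply: (det_tridiagonal (t := fun i j => Q_entry F i.+1 j.+1)) => i j lt_ij.
  by rewrite /Q_entry; do 3![case: eqP => [?|_]; first lia].
by rewrite /Q_entry; do 3![case: eqP => [?|_]; first lia].
Qed.

Lemma Q0 (F : fieldType) : Q F 0 = 1.
Proof. exact: det_mx00. Qed.

Lemma Q1 (F : fieldType) : Q F 1 = Q_entry F 1 1.
Proof. by rewrite /Q det_mx11 mxE. Qed.

(** The normalized value q_k as a polynomial in x, with y specialized to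
    n = 2N + 2; keeping x as a variable gives access to degrees in x. *)
Definition Qbar (F : fieldType) (N k : nat) : {poly F} :=
  ((2 * k + 1)`!%:R)^-1 *: map_poly (horner_eval (2 * N + 2)%:R) (Q F k).

Lemma horner_Qbar (F : fieldType) (N k : nat) (s : F) :
  (Qbar F N k).[s] = (Q F k).[s, (2 * N + 2)%:R] / ((2 * k + 1)`!)%:R.
Proof.
rewrite hornerZ mulrC; congr (_ / _).
have := horner_map (horner_eval (2 * N + 2)%:R) (Q F k) s%:P.
by rewrite /= /horner_eval hornerC.
Qed.

(** The preceding term of a sequence, under the convention w_(-1) = 0 that
    makes the initial condition an instance of the recurrence. *)
Definition prev (A : nmodType) (w : nat -> A) (k : nat) : A :=
  if k is k'.+1 then w k' else 0.

Section Values.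
Variable F : numFieldType.
Implicit Types (N k : nat) (s : F).

(** The relation at index k between x = w_(k-1), y = w_k and z = w_(k+1). *)
Definition three_term N k s (x y z : F) : Prop :=
  b (k%:R + 1) * z
  = 2%:R * (N%:R - 2%:R * k%:R) * s * y + b (N%:R - k%:R + 1) * x.

Lemma b_neq0 k : b (k%:R + 1 : F) != 0.
Proof.
have -> : b (k%:R + 1 : F) = ((2 * k.+1) * (2 * k.+1 + 1))%:R.
  by rewrite /b; ring.
by rewrite pnatr_eq0; lia.
Qed.

Lemma Qbar0 N : Qbar F N 0 = 1.
Proof. by rewrite /Qbar Q0 !rmorph1 invr1 scale1r. Qed.

Lemma eval_entry_diag N k :
  map_poly (horner_eval (2 * N + 2)%:R) (Q_entry F k.+1 k.+1)
  = (2%:R * (N%:R - 2%:R * k%:R)) *: 'X.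
Proof.
rewrite /Q_entry eqxx.
have -> : 'Y - 2%:R - 4%:R * (k.+1%:R - 1)
          = ('X - (2 + 4 * k)%:R%:P)%:P :> {poly {poly F}}.
  by rewrite polyC_natr rmorphB rmorph_nat /=; ring.
rewrite rmorphM /= map_polyX map_polyC /= /horner_eval -mul_polyC.
by rewrite hornerXsubC; congr (_%:P * _); ring.
Qed.

Lemma eval_entry_offdiag N k :
  map_poly (horner_eval (2 * N + 2)%:R)
    (Q_entry F k.+2 k.+1 * Q_entry F k.+1 k.+2)
  = (- (b (k%:R + 1) * b (N%:R - k%:R)))%:P.
Proof.
have -> : Q_entry F k.+2 k.+1 * Q_entry F k.+1 k.+2
          = (- (b (k%:R + 1) * b ((2%:R^-1)%:P * ('X - (2 * k.+1)%:R%:P))))%:P.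
  rewrite /Q_entry !eqxx !(gtn_eqF (ltnSn _)) !(ltn_eqF (ltnSn _)).
  rewrite (_ : (k.+1 == k.+3) = false); last lia.
  rewrite /b polyC_natr !(rmorphN, rmorphM, rmorphD, rmorphB).
  by rewrite !(rmorph1, rmorph_nat) /=; ring.
rewrite map_polyC /= /horner_eval; congr (_%:P).
rewrite hornerN /b -!(polyC_natr _ 2) -polyC1.
by rewrite !(hornerM, hornerD, hornerC, hornerN, hornerX, hornerMn); field.
Qed.

(** The factorials (2k+3)! / (2k+1)! supply b(k+1) on the left and cancel
    the factor b(k) of the product of the two off-diagonal entries, which
    leaves the two coefficients b(k+1) and b(N-k+1) exchanged by the
    reversal. *)
Lemma Qbar_recurrence N k :
  b (k%:R + 1) *: Qbar F N k.+1
  = (2%:R * (N%:R - 2%:R * k%:R)) *: ('X * Qbar F N k)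
    + b (N%:R - k%:R + 1) *: prev (Qbar F N) k.
Proof.
case: k => [|k] /=.
  rewrite Qbar0 /Qbar Q1 eval_entry_diag scaler0 addr0 mulr1 !scalerA.
  rewrite /b (_ : (2 * 1 + 1)`! = 6%N) //.
  by congr (_ *: _); field.
rewrite /Qbar Q_recurrence rmorphB [X in X - _]rmorphM [X in _ - X]rmorphM /=.
rewrite eval_entry_offdiag.
rewrite eval_entry_diag mul_polyC scaleNr opprK -scalerAl.
rewrite !scalerDr -scalerAr !scalerA.
have fact2 m : (2 * m.+1 + 1)`!%:R
               = (2 * m + 3)%:R * (2 * m + 2)%:R * (2 * m + 1)`!%:R :> F.
  rewrite -!natrM; congr (_%:R).
  by rewrite (_ : 2 * m.+1 + 1 = (2 * m + 1).+2)%N ?factS ?mulnA; lia.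
have f0 : (2 * k + 1)`!%:R != 0 :> F by rewrite pnatr_eq0 -lt0n fact_gt0.
rewrite !fact2; move: ((2 * k + 1)`!%:R : F) f0 => f f0.
have pos m : 2 * k%:R + m.+1%:R != 0 :> F.
  by rewrite -natrM -natrD pnatr_eq0 addnS.
have pos1 m : 2 * (1 + k%:R) + m.+1%:R != 0 :> F.
  by rewrite nat1r -natrM -natrD pnatr_eq0 addnS.
congr (_ + _); apply: (congr1 (fun c => c *: _)); rewrite /b; field;
  by rewrite f0 !pos !pos1.
Qed.

Lemma Qbar_three_term N k s :
  three_term N k s (prev (fun j => (Qbar F N j).[s]) k)
    (Qbar F N k).[s] (Qbar F N k.+1).[s].
Proof.
have := congr1 (horner^~ s) (Qbar_recurrence N k).
rewrite /three_term /= hornerD (hornerZ (b _)) (hornerZ (2%:R * _)).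
rewrite (hornerZ (b _)) hornerM hornerX mulrA.
by case: k => [|k] //=; rewrite horner0.
Qed.
End Values.

(** * Reversal of the recurrence *)

Section Palindromes.
Variable F : numFieldType.
Implicit Types (N k : nat) (s : F).

Definition solves N s K (w : nat -> F) : Prop :=
  forall k, (k < K)%N -> three_term N k s (prev w k) (w k) (w k.+1).

(** The source of all palindromic identities: reversing the index negates
    N - 2k and exchanges b(k+1) with b(N-k+1). *)
Lemma three_term_mirror N k s x y z : (k <= N)%N ->
  three_term N k s x y z -> three_term N (N - k) s z y x.
Proof.
move=> le_kN; rewrite /three_term natrB // => eq_xyz.
have -> : N%:R - (N%:R - k%:R) + 1 = k%:R + 1 :> F by ring.
by rewrite eq_xyz; ring.
Qed.

Lemma three_term_fun N k s x y z z' :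
  three_term N k s x y z -> three_term N k s x y z' -> z = z'.
Proof. by rewrite /three_term => <- /(mulfI (b_neq0 F k)). Qed.

Lemma three_termZ N k s a x y z :
  three_term N k s x y z -> three_term N k s (a * x) (a * y) (a * z).
Proof.
by rewrite /three_term => e; rewrite [b _ * _]mulrCA e; ring.
Qed.

Lemma solvesZ N s K a w : solves N s K w -> solves N s K (fun k => a * w k).
Proof.
move=> solw k /solw /(three_termZ a).
by case: k => [|k] //=; rewrite mulr0.
Qed.

Lemma solves_unique N s K w w' :
    solves N s K w -> solves N s K w' -> w 0%N = w' 0%N ->
  forall k, (k <= K)%N -> w k = w' k.
Proof.
move=> solw solw' eq0; elim/ltn_ind => -[|k] IH lt_kK //.
apply: three_term_fun (solw _ lt_kK) _; have := solw' _ lt_kK.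
rewrite (IH k) ?(ltnW lt_kK) //; case: k IH lt_kK => //= k IH lt_kK.
by rewrite (IH k) // ltnW // ltnW.
Qed.

(** The vanishing of w_(N+1) is the initial condition w_(-1) = 0 of the
    reversed sequence. *)
Lemma solves_mirror N s w : solves N s N.+1 w -> w N.+1 = 0 ->
  solves N s N (fun k => w (N - k)%N).
Proof.
move=> solw w0 k lt_kN; have := solw (N - k)%N; rewrite ltnS leq_subr.
move/(_ isT)/(three_term_mirror (leq_subr _ _)); rewrite subKn ?(ltnW lt_kN) //.
have -> : prev w (N - k) = w (N - k.+1)%N by rewrite -subnSK.
have -> // : w (N - k).+1 = prev (fun j => w (N - j)%N) k.
by case: k lt_kN => [|k] lt_kN; rewrite ?subn0 //= subnSK // ltnW.
Qed.

Definition qval N s k := (Qbar F N k).[s].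

Lemma qval0 N s : qval N s 0 = 1.
Proof. by rewrite /qval Qbar0 hornerC. Qed.

Lemma qval_solves N s K : solves N s K (qval N s).
Proof. move=> k _; exact: Qbar_three_term. Qed.

Lemma solves_qval N s w K k :
  solves N s K w -> (k <= K)%N -> w k = w 0%N * qval N s k.
Proof.
move=> solw.
apply: solves_unique solw (solvesZ (w 0%N) (@qval_solves N s K)) _ k.
by rewrite qval0 mulr1.
Qed.

(** Two consecutive zeros propagate; the second one, q_(N+2) = 0, holds
    because the coefficient b(N-k+1) = b(0) of q_N vanishes at k = N + 1. *)
Lemma qval_vanish N s : qval N s N.+1 = 0 ->
  forall k, (N < k)%N -> qval N s k = 0.
Proof.
move=> q0; elim/ltn_ind => -[|[|k]] // IH; rewrite ltnS leq_eqVlt.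
  by case: N q0 {IH}.
case/predU1P => [<-|lt_Nk] //.
apply: (@three_term_fun N k.+1 s (qval N s k) (qval N s k.+1)).
  exact: (Qbar_three_term N k.+1 s).
rewrite (IH k.+1) // /three_term !mulr0 add0r.
move: lt_Nk; rewrite ltnS leq_eqVlt => /predU1P[->|lt_Nk].
  have -> : k%:R - k.+1%:R + 1 = 0 :> F by ring.
  by rewrite /b; ring.
by rewrite (IH k) ?mulr0.
Qed.

(** The reversed sequence solves the recurrence, hence is proportional to q,
    with factor its value q_N at 0. *)
Lemma qval_mirror N s k : qval N s N.+1 = 0 -> (k <= N)%N ->
  qval N s k = qval N s N * qval N s (N - k).
Proof.
move=> q0 le_kN.
have := solves_qval (solves_mirror (@qval_solves N s N.+1) q0) (leq_subr k N).
by rewrite subKn // subn0.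
Qed.

Lemma qval_last N s : qval N s N.+1 = 0 ->
  qval N s N = 1 \/ qval N s N = -1.
Proof.
move/qval_mirror/(_ (leq0n N)); rewrite qval0 subn0 => /esym/eqP.
by rewrite -expr2 sqrf_eq1 => /orP[] /eqP; [left | right].
Qed.

(** Alternating signs turn the recurrence for s into the one for -s. *)
Lemma qval_parity N s k : qval N (- s) k = (-1) ^+ k * qval N s k.
Proof.
have sol : solves N (- s) k (fun j => (-1) ^+ j * qval N s j).
  move=> j _; have := three_termZ ((-1) ^+ j.+1) (Qbar_three_term N j s).
  rewrite /three_term -!/(qval _ _ _) => ->.
  by case: j => [|j] /=; rewrite ?mulr0 -?/(qval _ _ _) !exprS; ring.
by have := solves_qval sol (leqnn k); rewrite expr0 mul1r qval0 mul1r => ->.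
Qed.

(** For N = 2h the relation at k = h has no term in s, hence reads
    q_(h+1) = q_(h-1). The relations at h + i and h - i then propagate the
    symmetry outwards, up to q_(2h+1) = q_(-1) = 0. *)
Lemma qval_even N s : ~~ odd N -> qval N s N = 1 /\ qval N s N.+1 = 0.
Proof.
move=> evN; have [h defN] : exists h, N = h.*2 by exists N./2; lia.
pose q := qval N s.
have sym i : (i <= h)%N ->
    q (h + i)%N = q (h - i)%N /\ q (h + i).+1 = prev q (h - i).
  (* The last step i = h compares q_(2h+1) with q_(-1), whence prev. *)
  elim: i => [_|i IH lt_ih].
    rewrite addn0 subn0; split=> //.
    apply: (three_term_fun (Qbar_three_term N h s)).
    rewrite /three_term (_ : N%:R - 2 * h%:R = 0) ?mulr0 ?mul0r ?add0r; last first.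
      by rewrite defN -mul2n natrM subrr.
    by congr (b _ * _); rewrite defN -addnn natrD; ring.
  have [eq_i eq_i1] := IH (ltnW lt_ih).
  rewrite addnS eq_i1 -subnSK //=; split=> //.
  apply: (three_term_fun (Qbar_three_term N _ s)) => /=.
  rewrite -[(Qbar _ _ _).[_]]/(q (h + i)%N).
  rewrite -[X in three_term _ _ _ _ X]/(q (h + i).+1).
  rewrite eq_i eq_i1 -subnSK //=.
  have -> : (h + i).+1 = (N - (h - i.+1))%N by lia.
  by apply: three_term_mirror; [lia | exact: Qbar_three_term].
have [] := sym h (leqnn h).
by rewrite subnn /= addnn -defN /q qval0.
Qed.

End Palindromes.

(** * The differential equation of the generating function *)

Section Generating.
Variable F : numFieldType.
Implicit Types (N M n p q r i j k e : nat) (s : F) (f : {poly F}).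

Definition euler f : {poly F} := 'X * f^`().

(** Multiplication by c - e on the monomial of degree e. *)
Definition degree_op (c : F) f : {poly F} := c%:P * f - euler f.

(** The operator X^2 - Y^2 - s H in the sl_2 representation of polynomials of
    degree at most n, where X = d/dt, Y = t (n - E), H = n - 2E and E is the
    Euler operator. *)
Definition heun n s f : {poly F} :=
  f^`()^`() - 'X^2 * degree_op (n%:R - 1) (degree_op n%:R f)
  - s%:P * (n%:R%:P * f - 2%:P * euler f).

Lemma coef_euler f e : (euler f)`_e = e%:R * f`_e.
Proof.
by rewrite coefXM; case: e => [|e]; rewrite ?mul0r // coef_deriv mulr_natl.
Qed.

Lemma coef_degree_op c f e : (degree_op c f)`_e = (c - e%:R) * f`_e.
Proof. by rewrite coefB coefCM coef_euler mulrBl. Qed.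

(** On odd coefficients this operator is the three-term recurrence. *)
Lemma coef_heun N s f k :
  (heun (2 * N + 2) s f)`_(2 * k + 1)
  = b (k%:R + 1) * f`_(2 * k.+1 + 1)
    - 2 * (N%:R - 2 * k%:R) * s * f`_(2 * k + 1)
    - b (N%:R - k%:R + 1) * prev (fun l => f`_(2 * l + 1)) k.
Proof.
rewrite !coefB !coef_deriv !coefCM coefB !coefCM coef_euler coefXnM.
rewrite (_ : (2 * k + 1).+2 = 2 * k.+1 + 1)%N; last lia.
case: k => [|k] /=.
  by rewrite /b; ring.
rewrite (_ : (_ < 2)%N = false); last lia.
rewrite (_ : 2 * k.+1 + 1 - 2 = 2 * k + 1)%N; last lia.
by rewrite !coef_degree_op /b; ring.
Qed.

(** For p + q = n, these are the eigenvectors of X + Y. *)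
Definition bipower p q : {poly F} := (1 + 'X) ^+ p * (1 - 'X) ^+ q.

Lemma deriv_bipower p q :
  (1 - 'X^2) * (bipower p q)^`()
  = (p%:R * (1 - 'X) - q%:R * (1 + 'X)) * bipower p q.
Proof.
rewrite /bipower derivM !deriv_exp derivD derivB derivX derivC add0r sub0r.
case: p => [|p]; case: q => [|q]; rewrite /= ?exprS; ring.
Qed.

(** The logarithmic derivative of the product of powers is a rational function
    with denominator 1 - t^2, so the second order operator acts on it as
    multiplication by a rational function. *)
Lemma heun_first_order p q s f :
    (1 - 'X^2) * f^`() = (p%:R * (1 - 'X) - q%:R * (1 + 'X)) * f ->
  (1 - 'X^2) * heun (p + q) s f
  = (p%:R * (p%:R - q%:R - 1 - s%:P) * (1 - 'X) ^+ 2
     - q%:R * (p%:R - q%:R + 1 + s%:P) * (1 + 'X) ^+ 2) * f.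
Proof.
move=> E1.
have E2 : (1 - 'X^2) * f^`()^`()
    = (p%:R * (1 - 'X) - q%:R * (1 + 'X) + 2%:R * 'X) * f^`()
      - (p%:R + q%:R) * f.
  (* Differentiate the first order equation once more. *)
  have := congr1 (@deriv F) E1.
  rewrite 2!derivM.
  rewrite !(derivB, derivD, derivXn, derivX, derivC, derivM, derivMn) /= => e.
  transitivity ((0 - 'X^1 *+ 2) * f^`() + (1 - 'X^2) * f^`()^`()
                + 2 * 'X * f^`()).
    by ring.
  by rewrite e; ring.
rewrite /heun /degree_op /euler !(derivB, derivM, derivX, derivC).
rewrite polyCB polyC1 !polyC_natr !natrD.
move: f^`() f^`()^`() E1 E2 => f1 f2 E1 E2.
move: (p%:R : {poly F}) (q%:R : {poly F}) s%:P ('X : {poly F}) E1 E2.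
move=> P Q S x E1 E2.
(* The coefficient of f'' is 1 - x^4, so that E2 eliminates f'' without a
   further factor 1 - x^2; that factor is then spent on f'. *)
transitivity ((1 + x ^+ 2) * ((1 - x ^+ 2) * ((1 - x ^+ 2) * f2))
   + (1 - x ^+ 2) * ((2%:R * (P + Q - 1) * x ^+ 3 + 2%:R * S * x) * f1
     - (x ^+ 2 * (P + Q - 1) + S) * (P + Q) * f)); first by ring.
rewrite E2.
transitivity (((1 + x ^+ 2) * (P * (1 - x) - Q * (1 + x) + 2%:R * x)
   + 2%:R * (P + Q - 1) * x ^+ 3 + 2%:R * S * x) * ((1 - x ^+ 2) * f1)
   - (1 - x ^+ 2) * (1 + x ^+ 2 + x ^+ 2 * (P + Q - 1) + S) * (P + Q) * f);
  first by ring.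
by rewrite E1; ring.
Qed.

(** The bidiagonal action: (1 - t)^2 / (1 - t^2) and (1 + t)^2 / (1 - t^2) are
    the shifts between neighbouring products. At p = 0 or q = 0 the truncated
    predecessor is harmless because its coefficient is 0. *)
Lemma heun_bipower p q s :
  heun (p + q) s (bipower p q)
  = (p%:R * (p%:R - q%:R - 1 - s))%:P * bipower p.-1 q.+1
    - (q%:R * (p%:R - q%:R + 1 + s))%:P * bipower p.+1 q.-1.
Proof.
have nz : 1 - 'X^2 != 0 :> {poly F}.
  by rewrite -opprB oppr_eq0 monic_neq0 // monicXnsubC.
apply: (mulfI nz); rewrite (heun_first_order _ (deriv_bipower p q)).
have downE : (1 - 'X^2) * (p%:R * bipower p.-1 q.+1)
             = p%:R * (1 - 'X) ^+ 2 * bipower p q.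
  by rewrite /bipower; case: p => [|p] /=; rewrite ?exprS; ring.
have upE : (1 - 'X^2) * (q%:R * bipower p.+1 q.-1)
           = q%:R * (1 + 'X) ^+ 2 * bipower p q.
  by rewrite /bipower; case: q {downE} => [|q] /=; rewrite ?exprS; ring.
rewrite !(rmorphM, rmorphB, rmorphD, rmorph1, rmorph_nat) /=.
transitivity ((p%:R - q%:R - 1 - s%:P)
   * ((1 - 'X^2) * (p%:R * bipower p.-1 q.+1))
   - (p%:R - q%:R + 1 + s%:P)
   * ((1 - 'X^2) * (q%:R * bipower p.+1 q.-1))).
  by rewrite downE upE; ring.
by ring.
Qed.

(** * Polynomial solutions for s = 3 + 4j *)

Lemma heun_linear n s (c : F) f g :
  heun n s (c%:P * f + g) = c%:P * heun n s f + heun n s g.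
Proof.
rewrite /heun /degree_op /euler.
by rewrite !(derivB, derivD, derivM, derivC, derivX); ring.
Qed.

Lemma heun_sum n s m (c : nat -> F) (f : nat -> {poly F}) :
  heun n s (\sum_(i < m) (c i)%:P * f i)
  = \sum_(i < m) (c i)%:P * heun n s (f i).
Proof.
elim: m => [|m IH].
  have := heun_linear n s (-1) 0 0.
  by rewrite !big_ord0 mulr0 addr0 polyCN mulN1r addNr.
by rewrite !big_ord_recr /= addrC heun_linear IH addrC.
Qed.

(** Coefficients of the solution, found by requiring that the two
    contributions to each product with p, q odd cancel. The factor r - l makes
    them vanish after index r. *)
Definition weight r j i : F :=
  \prod_(l < i) ((r - l)%:R * (l + 2 * j + 2)%:R
                 / ((r + 2 * j + 3 + l)%:R * l.+1%:R)).

(** The solution for s = 3 + 4j and n = 4 (r + j + 1): the chain of products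
    with p, q even is entered at p = n/2 + 2 (j + 1), where the coefficient
    p - q - 1 - s of the downward neighbour vanishes. *)
Definition eigenpoly r j : {poly F} :=
  \sum_(i < r.+1) (weight r j i)%:P
                  * bipower (2 * (r + 2 * j + 2 + i)) (2 * (r - i)).

Lemma weight_ge0 r j i : 0 <= weight r j i.
Proof. by apply: prodr_ge0 => l _; rewrite divr_ge0 ?mulr_ge0 ?ler0n. Qed.

Lemma weightS r j i :
  (r + 2 * j + 3 + i)%:R * i.+1%:R * weight r j i.+1
  = (r - i)%:R * (i + 2 * j + 2)%:R * weight r j i.
Proof.
have D0 : (r + 2 * j + 3 + i)%:R * i.+1%:R != 0 :> F.
  by rewrite mulf_neq0 ?pnatr_eq0 // !addnS.
by rewrite /weight big_ord_recr /= mulrCA [_ * (_ / _)]mulrC divfK // mulrC.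
Qed.

(** Each term is sent to a difference T i - T i.+1 of multiples of its two
    neighbours; the sum telescopes, T 0 vanishing by the choice of s and
    T r.+1 because the weights stop at r. *)
Lemma heun_eigenpoly r j :
  heun (2 * (2 * (r + j) + 1) + 2) (3 + 4 * j)%:R (eigenpoly r j) = 0.
Proof.
rewrite (heun_sum _ _ _ (weight r j)
  (fun i => bipower (2 * (r + 2 * j + 2 + i)) (2 * (r - i)))).
pose T i := ((2 * (r + 2 * j + 2 + i))%:R * (4 * i)%:R * weight r j i)%:P
            * bipower (2 * (r + 2 * j + 2 + i)).-1 (2 * (r - i)).+1.
rewrite (eq_bigr (fun i : 'I_r.+1 => T i - T i.+1)); last first.
  case=> i /=; rewrite ltnS => le_ir _.
  have -> : (2 * (2 * (r + j) + 1) + 2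
             = 2 * (r + 2 * j + 2 + i) + 2 * (r - i))%N by lia.
  rewrite heun_bipower mulrBr ![_%:P * (_%:P * _)]mulrA -!polyCM; congr (_ - _).
    by rewrite /T; congr (_%:P * _); rewrite !natrM (natrB _ le_ir); ring.
  move: le_ir; rewrite leq_eqVlt => /predU1P[->|lt_ir].
    rewrite /T subnn muln0 /= mul0r mulr0 mul0r.
    have := weightS r j r; rewrite subnn !mul0r => /eqP.
    rewrite !mulf_eq0 -!orbA.
    rewrite !pnatr_eq0 !addnS /= => /eqP ->.
    by rewrite mulr0 mul0r.
  rewrite /T; have -> : (2 * (r - i)).-1 = (2 * (r - i.+1)).+1 by lia.
  have -> : (2 * (r + 2 * j + 2 + i)).+1 = (2 * (r + 2 * j + 2 + i.+1)).-1 by lia.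
  congr (_%:P * _).
  transitivity (8%:R * ((r + 2 * j + 3 + i)%:R * i.+1%:R * weight r j i.+1)).
    by rewrite weightS natrM (natrB _ (ltnW lt_ir)); ring.
  by ring.
rewrite -(big_mkord xpredT (fun i => T i - T i.+1)).
rewrite -[LHS]opprK -sumrN.
under eq_bigr do rewrite opprB.
rewrite telescope_sumr // /T muln0 mulr0 mul0r mul0r subr0.
have := weightS r j r; rewrite subnn !mul0r => /eqP.
rewrite !mulf_eq0 !pnatr_eq0 !addnS /= => /eqP ->.
by rewrite mulr0 mul0r oppr0.
Qed.

Definition palindromic d (c : F) f : Prop :=
  (forall i, (d < i)%N -> f`_i = 0)
  /\ (forall i j, (i + j)%N = d -> f`_i = c * f`_j).

(** Multiplication by 1 + t preserves palindromic polynomials and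
    multiplication by 1 - t exchanges them with the antipalindromic ones. *)
Lemma palindromic_mul1DX d (c a : F) f : a ^+ 2 = 1 ->
  palindromic d c f -> palindromic d.+1 (a * c) ((1 + a *: 'X) * f).
Proof.
move=> a2 [f0 pal].
have coefE i : ((1 + a *: 'X) * f)`_i = f`_i + a * prev (fun k => f`_k) i.
  by rewrite mulrDl mul1r -scalerAl coefD coefZ coefXM; case: i.
split=> [[|i] // lt_di | i j def_d].
  by rewrite coefE /= !f0 ?mulr0 ?addr0 // ltnW.
rewrite !coefE; case: i j def_d => [|i] [|j] //= [def_d].
- by rewrite (f0 j.+1) -?def_d // (pal 0%N j) //; ring: a2.
- rewrite addn0 in def_d.
  by rewrite (f0 i.+1) -?def_d // (pal i 0%N) ?addn0 //; ring.
- rewrite (pal i.+1 j) 1?(pal i j.+1); [|lia..].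
  by ring: a2.
Qed.

Lemma palindromic_bipower p q : palindromic (p + q) ((-1) ^+ q) (bipower p q).
Proof.
elim: q => [|q IH].
  rewrite addn0 expr0 /bipower expr0 mulr1; elim: p => [|p IH].
    split=> [i|[|i] [|j] //]; rewrite expr0 coef1 ?mul1r //.
    by case: i.
  have := palindromic_mul1DX (expr1n _ 2) IH.
  by rewrite scale1r mulr1 -exprS.
have := palindromic_mul1DX (sqrr_sign F 1) IH.
by rewrite scaleN1r addnS -exprS /bipower mulrCA -exprS.
Qed.

Lemma palindromic_sum d c m (a : nat -> F) (f : nat -> {poly F}) :
  (forall i, (i < m)%N -> palindromic d c (f i)) ->
  palindromic d c (\sum_(i < m) (a i)%:P * f i).
Proof.
move=> pal; split=> [k lt_dk | k l def_d]; rewrite !coef_sum ?mulr_sumr.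
  by apply: big1 => i _; rewrite coefCM (proj1 (pal i _)) ?mulr0.
apply: eq_bigr => i _; rewrite !coefCM (proj2 (pal i _) k l) //.
by rewrite mulrCA.
Qed.

Lemma palindromic_eigenpoly r j :
  palindromic (2 * (2 * (r + j) + 1) + 2) 1 (eigenpoly r j).
Proof.
apply: (palindromic_sum (weight r j)
  (f := fun i => bipower (2 * (r + 2 * j + 2 + i)) (2 * (r - i)))) => i lt_ir.
have -> : 1 = (-1) ^+ (2 * (r - i)) :> F by rewrite exprM sqrrN !expr1n.
have -> : (2 * (2 * (r + j) + 1) + 2
           = 2 * (r + 2 * j + 2 + i) + 2 * (r - i))%N by lia.
exact: palindromic_bipower.
Qed.

Lemma coef1_bipower p q : (bipower p q)`_1 = p%:R - q%:R.
Proof.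
have bipower_at0 : (bipower p q).[0] = 1.
  by rewrite /bipower hornerM !horner_exp !hornerE subr0 !expr1n mulr1.
have : ((1 - 'X^2) * (bipower p q)^`()).[0] = _ :=
  congr1 (horner^~ 0) (deriv_bipower p q).
rewrite 2!hornerM bipower_at0.
rewrite hornerD hornerN hornerXn hornerC expr0n subr0 mul1r.
rewrite horner_coef0 coef_deriv mulr1n => ->.
by rewrite mulr1 -!polyC_natr !hornerE subr0 mulr1.
Qed.

(** The product with exponents p, q has coefficient p - q at t, and all terms
    of the solution have p > q. *)
Lemma coef1_eigenpoly_gt0 r j : 0 < (eigenpoly r j)`_1.
Proof.
rewrite /eigenpoly coef_sum big_ord_recl /=.
apply: ltr_wpDr.
  apply: sumr_ge0 => i _; rewrite coefCM coef1_bipower mulr_ge0 ?weight_ge0 //.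
  by rewrite subr_ge0 ler_nat; lia.
rewrite coefCM coef1_bipower /weight big_ord0 mul1r subr_gt0 ltr_nat; lia.
Qed.

(** The odd coefficients of the solution are a nonzero multiple of the q_k;
    those of degree 1 and n - 1 agree by palindromicity, and the one of degree
    n + 1 is 0. *)
Lemma qval_eigenvalue N r j (s := (3 + 4 * j)%:R : F) :
  N = (2 * (r + j) + 1)%N -> qval N s N = 1 /\ qval N s N.+1 = 0.
Proof.
move=> defN.
pose w k := (eigenpoly r j)`_(2 * k + 1).
have solw K : solves N s K w.
  move=> k _; have := coef_heun N s (eigenpoly r j) k.
  rewrite defN heun_eigenpoly coef0 -defN => /esym/eqP.
  by rewrite -addrA -opprD subr_eq0 => /eqP.
have w0 : w 0%N != 0 by rewrite gt_eqF // coef1_eigenpoly_gt0.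
have [big pal] := palindromic_eigenpoly r j.
have qw k : qval N s k = w k / w 0%N.
  by rewrite (solves_qval (solw k) (leqnn k)) mulrAC divff ?mul1r.
split; rewrite qw.
  rewrite /w (pal _ 1%N) ?mul1r ?divff //; lia.
by rewrite /w big ?mul0r //; lia.
Qed.

End Generating.

(** * The zeros of the polynomial Q_(N+1) *)

Section Zeros.
Variable F : numFieldType.
Implicit Types (N M k j : nat) (s : F).

(** For N odd no diagonal coefficient N - 2k vanishes, so the degree in x
    grows by exactly one at each step. *)
Lemma size_Qbar N k : odd N ->
  (size (Qbar F N k) <= k.+1)%N && ((Qbar F N k)`_k != 0).
Proof.
move=> oddN; elim/ltn_ind: k => -[|k] IH.
  by rewrite Qbar0 size_poly1 coef1 oner_eq0.
have /andP[sz_k lead_k] := IH k (ltnSn k).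
have sz_prev : (size (prev (Qbar F N) k) <= k.+1)%N.
  case: k IH {sz_k lead_k} => [|k] IH /=; first by rewrite size_poly0.
  by have /andP[/leq_trans-> //] := IH k (leqW (ltnSn k)).
have bk := b_neq0 F k.
have defQ : Qbar F N k.+1 = (b (k%:R + 1))^-1 *:
    ((2%:R * (N%:R - 2%:R * k%:R)) *: ('X * Qbar F N k)
     + b (N%:R - k%:R + 1) *: prev (Qbar F N) k).
  by rewrite -Qbar_recurrence scalerA mulVf // scale1r.
have szX : (size ('X * Qbar F N k)%R <= k.+2)%N.
  by rewrite (leq_trans (size_polyMleq _ _)) // size_polyX.
apply/andP; split.
  rewrite defQ (leq_trans (size_scale_leq _ _)) //.
  rewrite (leq_trans (size_polyD _ _)) //.
  by rewrite geq_max !(leq_trans (size_scale_leq _ _)) // (leq_trans sz_prev).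
rewrite defQ coefZ coefD !coefZ coefXM /= (nth_default _ sz_prev) mulr0 addr0.
rewrite !mulf_neq0 ?invr_eq0 // ?pnatr_eq0 // subr_eq0 -natrM eqr_nat.
by apply: contraTneq oddN => ->; rewrite oddM.
Qed.

(** The 2M known zeros exhaust the degree N + 1 = 2M. *)
Lemma qval_zero N M s : (N.+1 = 2 * M)%N -> qval N s N.+1 = 0 ->
  exists2 j, (j < M)%N & s = (3 + 4 * j)%:R \/ s = - (3 + 4 * j)%:R.
Proof.
move=> defN q0.
pose pos := [seq (3 + 4 * j)%:R : F | j <- iota 0 M].
pose rs := pos ++ [seq - x | x <- pos].
have [s_rs | s'rs] := boolP (s \in rs).
  move: s_rs; rewrite mem_cat => /orP[/mapP[j] | /mapP[x /mapP[j]]].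
    by rewrite mem_iota => lt_jM ->; exists j => //; left.
  by rewrite mem_iota => lt_jM -> ->; exists j => //; right.
have oddN : odd N by lia.
have /andP[szQ leadQ] := size_Qbar N.+1 oddN.
have nzQ : Qbar F N N.+1 != 0.
  by apply: contraNneq leadQ => ->; rewrite coef0.
have root_pos j : (j < M)%N -> qval N (3 + 4 * j)%:R N.+1 = 0 :> F.
  move=> lt_jM; have defN' : N = (2 * (M - j.+1 + j) + 1)%N by lia.
  by have [_ ->] := qval_eigenvalue F defN'.
have uniq_pos : uniq pos.
  rewrite map_inj_uniq ?iota_uniq // => i j /= /eqP.
  by rewrite eqr_nat; lia.
have uniq_rs : uniq (s :: rs).
  rewrite /= s'rs cat_uniq uniq_pos map_inj_uniq ?uniq_pos ?andbT;
    last exact: oppr_inj.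
  apply/hasPn => _ /mapP[_ /mapP[i _ ->] ->]; apply/mapP => -[j _] /eqP.
  by rewrite eq_sym -subr_eq0 opprK -natrD pnatr_eq0.
have all_rs : all (root (Qbar F N N.+1)) (s :: rs).
  rewrite /= /root -/(qval _ _ _) q0 eqxx all_cat /=; apply/andP; split.
    by apply/allP => _ /mapP[j + ->]; rewrite mem_iota => /root_pos <-.
  apply/allP => _ /mapP[_ /mapP[j + ->] ->]; rewrite mem_iota => /root_pos q_j.
  by rewrite -/(qval _ _ _) qval_parity q_j mulr0.
have := leq_trans (max_poly_roots nzQ all_rs uniq_rs) szQ.
by rewrite /= size_cat !size_map size_iota; lia.
Qed.

Lemma qval_last_odd N M s : (N.+1 = 2 * M)%N ->
  (exists2 j, (j < M)%N & s = (3 + 4 * j)%:R \/ s = - (3 + 4 * j)%:R) ->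
  qval N s N = Num.sg s /\ qval N s N.+1 = 0.
Proof.
move=> defN [j lt_jM def_s].
have [q1 q0] : qval N (3 + 4 * j)%:R N = 1 :> F
             /\ qval N (3 + 4 * j)%:R N.+1 = 0 :> F.
  by apply: (@qval_eigenvalue F N (M - j.+1) j); lia.
have pos_j : 0 < (3 + 4 * j)%:R :> F by rewrite ltr0n.
have oddN : odd N by lia.
case: def_s => ->; first by rewrite gtr0_sg.
by rewrite ltr0_sg ?oppr_lt0 // !qval_parity q1 q0 -signr_odd oddN mulr0 mulr1.
Qed.

Lemma qval_theta N s : qval N s N.+1 = 0 -> qval N s N = theta_Q (2 * N + 2) s.
Proof.
move=> q0; rewrite /theta_Q; case: ifP => n4.
  have [M defN] : exists M, (N.+1 = 2 * M)%N by exists (N.+1 %/ 2)%N; lia.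
  by have [] := qval_last_odd defN (qval_zero defN q0).
have evN : ~~ odd N by lia.
by have [] := qval_even s evN.
Qed.

Lemma Q_eq0 N s k : ((Q F k).[s, (2 * N + 2)%:R] = 0) <-> (qval N s k = 0).
Proof.
rewrite /qval horner_Qbar; split=> [->|/eqP]; first by rewrite mul0r.
rewrite mulf_eq0 invr_eq0 pnatr_eq0 -[(_`!)%N == 0%N]negbK -lt0n fact_gt0.
by rewrite orbF => /eqP.
Qed.

Lemma Q_mirror N s k : qval N s N.+1 = 0 -> (k <= N)%N ->
  (Q F k).[s, (2 * N + 2)%:R] / ((2 * k + 1)`!)%:R
  = qval N s N * ((Q F (N - k)).[s, (2 * N + 2)%:R] / ((2 * (N - k) + 1)`!)%:R).
Proof. by move=> q0 le_kN; rewrite -!horner_Qbar; apply: qval_mirror. Qed.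

End Zeros.

(** * Palindromic identities *)

Theorem theorem7p41 (R : realType) :
  [/\ palindromic_pair (Q R[i]) (fun k : nat => ((2 * k + 1)`!)%:R)
        (fun n : nat => (n%:R - 2%:R) / 2%:R),
      (forall n : nat, (2 <= n)%N -> (2 %| n)%N ->
        forall s : R[i], zero_set (Q R[i]) (n %/ 2) n s ->
          [/\ theta_Q n s = 1 \/ theta_Q n s = -1,
              forall k : nat, (n %/ 2 <= k)%N -> (Q R[i] k).[s, n%:R] = 0
            & forall k : nat, (k <= (n - 2) %/ 2)%N ->
                (Q R[i] k).[s, n%:R] / ((2 * k + 1)`!)%:R =
                theta_Q n s *
                ((Q R[i] ((n - 2) %/ 2 - k)).[s, n%:R] / ((n - 2 * k - 1)`!)%:R)]),
      (forall n : nat, (2 <= n)%N -> n = 0 %[mod 4] ->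
        forall s : R[i], (I0_plus n `|` I0_minus n)%classic s ->
        forall k : nat, (k <= n %/ 2 - 1)%N ->
          (Q R[i] k).[s, n%:R] / ((2 * k + 1)`!)%:R =
          Num.sg s *
          ((Q R[i] ((n - 2) %/ 2 - k)).[s, n%:R] / ((n - 2 * k - 1)`!)%:R))
    & (forall n : nat, (2 <= n)%N -> n = 2 %[mod 4] ->
        forall s : R[i], forall k : nat, (k <= n %/ 2 - 1)%N ->
          (Q R[i] k).[s, n%:R] / ((2 * k + 1)`!)%:R =
          (Q R[i] ((n - 2) %/ 2 - k)).[s, n%:R] / ((n - 2 * k - 1)`!)%:R)].
Proof.
have half N : ((2 * N + 2) %/ 2 = N.+1)%N by lia.
have half2 N : ((2 * N + 2 - 2) %/ 2 = N)%N by lia.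
have fact_arg N k : (k <= N)%N ->
  (2 * N + 2 - 2 * k - 1 = 2 * (N - k) + 1)%N by lia.
split.
- split=> [|k|n N]; first exact: Q0.
    by rewrite pnatr_eq0 -lt0n fact_gt0.
  move=> dN; have {dN} -> : n = (2 * N + 2)%N.
    by apply/eqP; rewrite -(eqr_nat R) natrD natrM -dN; apply/eqP; field.
  exists (fun s => qval N s N) => s /Q_eq0 q0; split; first exact: qval_last.
    by move=> k lt_Nk; apply/Q_eq0/(qval_vanish q0).
  by move=> k; apply: Q_mirror.
- move=> n n_ge2 n2; have [N ->] : exists N, n = (2 * N + 2)%N.
    by exists ((n - 2) %/ 2)%N; lia.
  rewrite half half2 => s /Q_eq0 q0; rewrite -(qval_theta q0); split.
  + exact: qval_last.
  + by move=> k lt_Nk; apply/Q_eq0/(qval_vanish q0).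
  + by move=> k le_kN; rewrite fact_arg //; apply: Q_mirror.
- move=> n n_ge2 n4; have [M ->] : exists M, n = (4 * M.+1)%N.
    by exists (n %/ 4).-1; lia.
  pose N := (2 * M + 1)%N; have defN : (N.+1 = 2 * M.+1)%N by rewrite /N; lia.
  have -> : (4 * M.+1 = 2 * N + 2)%N by rewrite /N; lia.
  rewrite half half2 subn1 /= => s in_I k le_kN.
  have [|<- q0] := @qval_last_odd _ N M.+1 s defN; last first.
    by rewrite fact_arg //; apply: Q_mirror.
  have lt_jM j : (j < (2 * N + 2) %/ 4)%N -> (j < M.+1)%N by rewrite /N; lia.
  by case: in_I => -[j /lt_jM lt_j ->]; exists j => //; [left | right].
- move=> n n_ge2 n4; have [N defn] : exists N, n = (2 * N + 2)%N.
    by exists ((n - 2) %/ 2)%N; lia.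
  have evN : ~~ odd N by lia.
  rewrite defn half half2 subn1 /= => s k le_kN.
  have [qN q0] := qval_even s evN.
  by rewrite fact_arg // Q_mirror // qN mul1r.
Qed.
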